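(* Let $A$ be a unital commutative ring, let $\pi$ be an ideal of $A$, and let $n\geq 3$. Then the inclusions $\Gamma_n(\pi^2)\subseteq \Delta_n(\pi)\subseteq \Gamma_n(\pi)$ induce (well-defined) surjections $$\Gamma_n(\pi^2)/\mathrm{E}_n(\pi^2)\twoheadrightarrow \Delta_n(\pi)/\mathrm{F}_n(\pi)\twoheadrightarrow \Gamma_n(\pi)/\mathrm{E}_n(\pi).$$
   Context: For a unital commutative ring $A$, $a\in A$ and indices $i\neq j$ in $\{1,\dots,n\}$, the elementary matrix $e_{ij}(a)\in \mathrm{SL}_n(A)$ is $1_n+a e_{ij}$, where $1_n$ is the identity matrix and $e_{ij}$ is the matrix unit with $1$ in the $(i,j)$-entry and $0$ elsewhere. $\mathrm{E}_n(A)$ is the subgroup of $\mathrm{SL}_n(A)$ generated by all $e_{ij}(a)$ with $a\in A$, $i\neq j$. For an ideal $\pi$ of $A$ (and $\pi^2$ denoting the product ideal $\pi\cdot\pi$), define the following subgroups of $\mathrm{SL}_n(A)$: - the normal elementary subgroup $\mathrm{E}_n(\pi)$: the normal subgroup of $\mathrm{E}_n(A)$ generated by (i.e. the normal closure in $\mathrm{E}_n(A)$ of) the matrices $e_{ij}(a)$ with $a\in\pi$, $i\neq j$; - the true elementary subgroup $\mathrm{F}_n(\pi)$: the subgroup generated by the matrices $e_{ij}(a)$ with $a\in\pi$, $i\neq j$; - the principal congruence subgroup $\Gamma_n(\pi)=\{g\in \mathrm{SL}_n(A): g\equiv 1_n \bmod \pi\}$; - the secondary congruence subgroup $\Delta_n(\pi)=\{g\in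 \mathrm{SL}_n(A): g\equiv 1_n \bmod \pi,\ g_{ii}\equiv 1 \bmod \pi^2 \text{ for all } i\}$. For a subgroup $H$ of a group $G$, $G/H$ denotes the coset space $\{gH : g\in G\}$; the induced maps send the coset of $g$ to the coset of $g$. *)

(* Defs.v *)
From HB Require Import structures.
From mathcomp Require Import all_boot all_algebra.
From mathcomp Require Import boolp classical_sets functions.

Set Implicit Arguments.
Unset Strict Implicit.
Unset Printing Implicit Defensive.

Import GRing.Theory.
Local Open Scope classical_set_scope.
Local Open Scope ring_scope.

Section Ideals.
(* comPzRingType rather than comNzRingType: the zero ring is a unital          *)
(* commutative ring.                                                            *)
Variable A : comPzRingType.

(* The unit ideal is allowed, unlike in ring_quotient. *)
Definition is_ideal (I : set A) : Prop :=
  [/\ I 0, (forall x y, I x -> I y -> I (x + y))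
         & (forall a x, I x -> I (a * x))].

Definition ideal_mul (I J : set A) : set A :=
  smallest is_ideal [set x * y | x in I & y in J].

End Ideals.

Section Subgroups.
Variable G : groupType.
Local Open Scope group_scope.

Definition is_subgroup (H : set G) : Prop :=
  [/\ H 1, (forall x y, H x -> H y -> H (x * y)) & (forall x, H x -> H x^-1)].

Definition generated (S : set G) : set G := smallest is_subgroup S.

(* x ^ k is the conjugate k^-1 * x * k. *)
Definition is_normal_subgroup (K N : set G) : Prop :=
  [/\ is_subgroup N, N `<=` K & forall k x, K k -> N x -> N (x ^ k)].

Definition normal_closure (K S : set G) : set G :=
  smallest (is_normal_subgroup K) S.

Definition left_coset (g : G) (H : set G) : set G := [set g * h | h in H].

Definition coset_space (K H : set G) : set (set G) :=
  [set left_coset g H | g in K].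

(* f is a total function on set G; only its values on the cosets in             *)
(* coset_space K1 H1 matter.  The first clause makes the map gH1 |-> gH2        *)
(* well defined.                                                                *)
Definition induces_surjection (K1 H1 K2 H2 : set G) : Prop :=
  exists f : set G -> set G,
    [/\ forall g, K1 g -> f (left_coset g H1) = left_coset g H2,
        set_fun (coset_space K1 H1) (coset_space K2 H2) f
      & set_surj (coset_space K1 H1) (coset_space K2 H2) f].

End Subgroups.

Section SpecialLinearGroup.
Variables (A : comPzRingType) (n : nat).

Record SL : Type := MkSL { SLval :> 'M[A]_n; _ : \det SLval == 1 }.
HB.instance Definition _ := [isSub for SLval].
HB.instance Definition _ := [Choice of SL by <:].

Lemma det_SL (g : SL) : \det g = 1.
Proof. by apply/eqP; case: g. Qed.

Fact SL_mul_subproof (g h : SL) : \det (g *m h) == 1.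
Proof. by rewrite det_mulmx !det_SL mulr1. Qed.
Fact SL_one_subproof : \det (1%:M : 'M[A]_n) == 1.
Proof. by rewrite det1. Qed.
Fact SL_inv_subproof (g : SL) : \det (\adj g) == 1.
Proof.
by rewrite -[X in X == _]mul1r -(det_SL g) -det_mulmx mul_mx_adj det_SL det1.
Qed.

Definition SL_mul (g h : SL) : SL := MkSL (SL_mul_subproof g h).
Definition SL_one : SL := MkSL SL_one_subproof.
Definition SL_inv (g : SL) : SL := MkSL (SL_inv_subproof g).

Fact SL_mulA : associative SL_mul.
Proof. by move=> x y z; apply: val_inj; rewrite /= mulmxA. Qed.
Fact SL_mul1g : left_id SL_one SL_mul.
Proof. by move=> x; apply: val_inj; rewrite /= mul1mx. Qed.
Fact SL_mulg1 : right_id SL_one SL_mul.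
Proof. by move=> x; apply: val_inj; rewrite /= mulmx1. Qed.
Fact SL_mulVg : left_inverse SL_one SL_inv SL_mul.
Proof. by move=> x; apply: val_inj; rewrite /= mul_adj_mx det_SL. Qed.
Fact SL_mulgV : right_inverse SL_one SL_inv SL_mul.
Proof. by move=> x; apply: val_inj; rewrite /= mul_mx_adj det_SL. Qed.

HB.instance Definition _ :=
  isGroup.Build SL SL_mulA SL_mul1g SL_mulg1 SL_mulVg SL_mulgV.

Definition elem_mx (i j : 'I_n) (a : A) : 'M[A]_n := 1%:M + a *: delta_mx i j.

Fact det_elem_mx (i j : 'I_n) (a : A) : i != j -> \det (elem_mx i j a) == 1.
Proof.
have low (k l : 'I_n) : (l < k)%N -> \det (elem_mx k l a) == 1.
  move=> lk; rewrite det_trig.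
    rewrite big1 // => m _; rewrite !mxE eqxx.
    case: (m =P k) => [->|_]; rewrite ?mulr0 ?addr0 //=.
    by rewrite -val_eqE /= (gtn_eqF lk) mulr0 addr0.
  apply/is_trig_mxP => p q pq; rewrite !mxE -val_eqE /= (ltn_eqF pq) add0r.
  case: (p =P k) => [pk|_]; rewrite ?mulr0 //=.
  case: (q =P l) => [ql|_]; rewrite ?mulr0 //=.
  by move: pq; rewrite pk ql ltnNge (ltnW lk).
rewrite -val_eqE neq_ltn => /orP[ij|/low //].
by rewrite -det_tr /elem_mx linearD /= tr_scalar_mx linearZ /= trmx_delta low.
Qed.

Definition elem (i j : 'I_n) (ij : i != j) (a : A) : SL :=
  MkSL (det_elem_mx a ij).

Definition elem_set (I : set A) : set SL :=
  [set g | exists (i j : 'I_n) (ij : i != j) (a : A), I a /\ g = elem ij a].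

Definition elementary_group : set SL := generated (elem_set setT).

Definition normal_elementary (I : set A) : set SL :=
  normal_closure elementary_group (elem_set I).

Definition true_elementary (I : set A) : set SL := generated (elem_set I).

Definition principal_congruence (I : set A) : set SL :=
  [set g | forall i j, I ((g : 'M[A]_n) i j - (1%:M : 'M[A]_n) i j)].

Definition secondary_congruence (I : set A) : set SL :=
  [set g | principal_congruence I g /\
           forall i, ideal_mul I I ((g : 'M[A]_n) i i - 1)].

End SpecialLinearGroup.

Arguments elem_set {A} n I.
Arguments normal_elementary {A} n I.
Arguments true_elementary {A} n I.
Arguments principal_congruence {A} n I.
Arguments secondary_congruence {A} n I.

(* Main.v *)
Require Import Defs.
From mathcomp Require Import all_boot all_algebra.
From mathcomp Require Import ssrAC perm.
From mathcomp Require Import boolp classical_sets functions.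

Import GRing.Theory.

Local Open Scope classical_set_scope.
Local Open Scope ring_scope.

(** Once a few inclusions between subgroups are known, an induced map of coset
    spaces is onto as soon as every element of the large group can be moved into
    the small one by right multiplication ([induces_surjectionP]).  Three facts
    carry the proof.

    (1) The normal elementary subgroup of I^2 lies in the true elementary
    subgroup of I ([normal_elementary_sub_true]).  A conjugate of e_ij(a) in
    SL_n(A) is a transvection 1 + a v w, with v a column of a matrix, w a row of
    its inverse, w v = 0, and u v = 1 for another row u.  Because u v = 1, the
    row w is a combination of the Koszul rows v_l e_k - v_k e_l; these kill v,
    so the transvection is a product of transvections whose rows have at most
    two nonzero entries.  As n >= 3, each such row vanishes at some m.
    Splitting off the m-th coordinate of v leaves a column that vanishes at m
    too, and then, for x, y in I, 1 + x y v w is the commutator of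
    1 + x v e_m and 1 + y e_m w, two products of elementary matrices with
    entries in I ([transvection_mul]).

    (2) Modulo I^2 the group law on matrices 1 + X with X in M_n(I) is the
    addition of the matrices X ([linear_partM]).  Prescribing the linear part of
    an element of a subgroup is thus an additive problem
    ([linear_parts_sum]).  Elementary matrices realise every matrix over I with
    zero diagonal, which reduces the secondary congruence subgroup of I to the
    principal one of I^2 ([secondary_congruence_mod_true]).

    (3) The determinant of 1 + X is 1 + tr X modulo I^2, so the diagonal of
    g - 1 sums to zero modulo I^2 for g congruent to 1 modulo I
    ([congruence_trace]).  Conjugating e_im(a) by e_mi(-1) gives a linear part
    with diagonal entries -a at i and a at m, and such elements remove
    every diagonal of trace zero
    ([principal_congruence_mod_normal]). *)

(** * Cosets and generated subgroups *)

Section Closures.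

Lemma generated_subgroup (G : groupType) (S : set G) :
  is_subgroup (generated S).
Proof.
split=> [H [[H1 _ _] _] //|x y Sx Sy H HS|x Sx H HS].
  by case: (HS) => -[_ HM _] _; apply: HM; [apply: Sx|apply: Sy].
by case: (HS) => -[_ _ HV] _; apply: HV; apply: Sx.
Qed.

Lemma normal_closure_normal (G : groupType) (K S : set G) :
  is_subgroup K -> S `<=` K -> (forall k x, K k -> K x -> K (x ^ k)%g) ->
  is_normal_subgroup K (normal_closure K S).
Proof.
move=> sK SK KJ; split; first split.
- by move=> H [[[H1 _ _] _ _] _].
- move=> x y Sx Sy H HS; case: (HS) => -[[_ HM _] _ _] _.
  by apply: HM; [apply: Sx|apply: Sy].
- move=> x Sx H HS; case: (HS) => -[[_ _ HV] _ _] _.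
  by apply: HV; apply: Sx.
- by apply: smallest_sub => //; split.
- move=> k x Kk Sx H HS; case: (HS) => -[_ _ HJ] _.
  by apply: HJ => //; apply: Sx.
Qed.

Lemma subgroup_conjg (G : groupType) (K : set G) k x :
  is_subgroup K -> K k -> K x -> K (x ^ k)%g.
Proof.
by move=> [_ KM KV] Kk Kx; rewrite conjgE; apply: KM (KV _ Kk) (KM _ _ Kx Kk).
Qed.

Lemma left_coset_mul (G : groupType) (H : set G) g h :
  is_subgroup H -> H h -> left_coset (g * h)%g H = left_coset g H.
Proof.
move=> [H1 HM HV] Hh; apply/seteqP; split=> _ [k Hk <-].
  by exists (h * k)%g; [apply: HM|rewrite mulgA].
by exists (h^-1 * k)%g; [apply: HM => //; apply: HV|rewrite mulgA mulgK].
Qed.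

(** The induced map sends X to the product set X H2; on a coset of H1 this
    gives a coset of H2 because H1 is contained in H2. *)
Lemma induces_surjectionP (G : groupType) (K1 H1 K2 H2 : set G) :
  is_subgroup H1 -> is_subgroup H2 -> H1 `<=` H2 -> K1 `<=` K2 ->
  (forall g, K2 g -> exists2 h, H2 h & K1 (g * h)%g) ->
  induces_surjection K1 H1 K2 H2.
Proof.
move=> sH1 sH2 H12 K12 cover.
have [[one1 _ _] [one2 mul2 _]] := (sH1, sH2).
pose f X := [set (x * h)%g | x in X & h in H2].
have fE g : f (left_coset g H1) = left_coset g H2.
  apply/seteqP; split=> [_ [_ [h1 Hh1 <-]] [h2 Hh2 <-]|_ [h Hh <-]].
    by exists (h1 * h2)%g; [apply: mul2 => //; apply: H12|rewrite mulgA].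
  by exists g; [exists 1%g; rewrite ?mulg1|exists h].
exists f; split=> [g _|_ [g Kg <-]|_ [g Kg <-]]; first exact: fE.
  by rewrite fE; exists g => //; apply: K12.
have [h Hh Kgh] := cover _ Kg.
exists (left_coset (g * h)%g H1); first by exists (g * h)%g.
by rewrite fE left_coset_mul.
Qed.

End Closures.

(** * Ideals *)

Section Ideals.
Variables (A : comPzRingType) (I : set A).
Hypothesis idI : is_ideal I.

Lemma ideal0 : I 0. Proof. by case: idI. Qed.

Lemma idealD x y : I x -> I y -> I (x + y).
Proof. by case: idI => _ + _; apply. Qed.

Lemma idealMl a x : I x -> I (a * x).
Proof. by case: idI => _ _; apply. Qed.

Lemma idealMr a x : I x -> I (x * a).
Proof. by rewrite mulrC; apply: idealMl. Qed.

Lemma idealN x : I x -> I (- x).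
Proof. by rewrite -mulN1r; apply: idealMl. Qed.

Lemma ideal_sum (T : Type) (r : seq T) (P : pred T) (F : T -> A) :
  (forall t, P t -> I (F t)) -> I (\sum_(t <- r | P t) F t).
Proof. by move=> IF; apply: big_ind => //; [apply: ideal0|apply: idealD]. Qed.

Lemma ideal_mul_ideal (J : set A) : is_ideal (ideal_mul I J).
Proof.
split=> [H [[H0 _ _] _] //|x y Sx Sy H HS|a x Sx H HS].
  by case: (HS) => -[_ HD _] _; apply: HD; [apply: Sx|apply: Sy].
by case: (HS) => -[_ _ HM] _; apply: HM; apply: Sx.
Qed.

Lemma ideal_mulM (J : set A) x y : I x -> J y -> ideal_mul I J (x * y).
Proof. by move=> Ix Jy; apply: sub_gen_smallest; exists x => //; exists y. Qed.

Lemma ideal_mul_sub : ideal_mul I I `<=` I.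
Proof.
by apply: smallest_sub => // _ [x Ix] [y Iy <-]; apply: idealMl.
Qed.

End Ideals.

(** * Transvections in a subgroup *)

Lemma ord_avoid (n : nat) (n_ge3 : (3 <= n)%N) (k l : 'I_n) :
  exists m : 'I_n, (m != k) && (m != l).
Proof.
have /subsetPn[m _] : ~~ ([set: 'I_n] \subset [set k; l])%SET.
  apply/negP=> /subset_leq_card; rewrite cardsT card_ord cards2.
  by move=> /(leq_trans n_ge3); case: (k != l).
by rewrite !inE negb_or => /andP[mk ml]; exists m; rewrite mk.
Qed.

Section Transvections.
Variables (A : comPzRingType) (n : nat).

(** Membership of explicit matrices in a subgroup of SL_n, without having to
    exhibit a proof that their determinant is 1. *)
Definition matrices (H : set (SL A n)) : set 'M[A]_n := @SLval A n @` H.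

Lemma SLvalM (g h : SL A n) : SLval (g * h)%g = SLval g *m SLval h.
Proof. by []. Qed.

Section Subgroup.
Variable H : set (SL A n).
Hypothesis subH : is_subgroup H.

Lemma matrices1 : matrices H 1%:M.
Proof. by case: subH => H1 _ _; exists 1%g. Qed.

Lemma matricesM (M N : 'M[A]_n) :
  matrices H M -> matrices H N -> matrices H (M *m N).
Proof.
case: subH => _ HM _ [g Hg <-] [h Hh <-].
by exists (g * h)%g; first exact: HM.
Qed.

Lemma matrices_SL (g : SL A n) : matrices H (SLval g) -> H g.
Proof. by case=> h Hh /val_inj <-. Qed.

Lemma matrices_add1 (X Y : 'M[A]_n) :
  X *m Y = 0 -> matrices H (1%:M + X) -> matrices H (1%:M + Y) ->
  matrices H (1%:M + (X + Y)).
Proof.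
move=> XY0 HX HY; suff -> : 1%:M + (X + Y) = (1%:M + X) *m (1%:M + Y).
  exact: matricesM.
by rewrite mulmxDl mul1mx mulmxDr mulmx1 XY0 addr0 [RHS]addrAC addrA.
Qed.

(** When all products X s *m X t vanish, the matrices 1 + X t multiply by adding
    the X t. *)
Lemma matrices_sum1 (T : Type) (r : seq T) (P : pred T) (X : T -> 'M[A]_n) :
  (forall s t, P s -> P t -> X s *m X t = 0) ->
  (forall t, P t -> matrices H (1%:M + X t)) ->
  matrices H (1%:M + \sum_(t <- r | P t) X t).
Proof.
move=> XX0 HX.
suff [] : matrices H (1%:M + \sum_(t <- r | P t) X t) /\
    forall s, P s -> X s *m \sum_(t <- r | P t) X t = 0 by [].
apply: (big_rec (fun Y => matrices H (1%:M + Y) /\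
                          forall s, P s -> X s *m Y = 0)).
  by rewrite addr0; split=> [|s _]; [apply: matrices1|rewrite mulmx0].
move=> t Y Pt [HY XY0]; split=> [|s Ps].
  by apply: matrices_add1 => //; [apply: XY0|apply: HX].
by rewrite mulmxDr XX0 // XY0 // addr0.
Qed.

(** Since P and Q square to zero, 1 - P and 1 - Q are the inverses of 1 + P and
    1 + Q; as Q P = 0, the commutator of these two reduces to 1 + P Q. *)
Lemma matrices_commutator (P Q : 'M[A]_n) :
  P *m P = 0 -> Q *m Q = 0 -> Q *m P = 0 ->
  matrices H (1%:M + P) -> matrices H (1%:M + Q) ->
  matrices H (1%:M - P) -> matrices H (1%:M - Q) ->
  matrices H (1%:M + P *m Q).
Proof.
move=> PP QQ QP HP HQ HP' HQ'.
suff -> : 1%:M + P *m Q =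
    (1%:M + P) *m (1%:M + Q) *m ((1%:M - P) *m (1%:M - Q)).
  by do !apply: matricesM.
have -> : (1%:M - P) *m (1%:M - Q) = 1%:M - P - Q + P *m Q.
  rewrite mulmxBl mul1mx mulmxBr mulmx1 opprB.
  by rewrite [LHS](AC (2*2) (1*4*2*3)).
have PZ : P *m (1%:M - P - Q + P *m Q) = P - P *m Q.
  by rewrite mulmxDr !mulmxBr mulmx1 mulmxA PP mul0mx subr0 addr0.
have QZ : Q *m (1%:M - P - Q + P *m Q) = Q.
  by rewrite mulmxDr !mulmxBr mulmx1 mulmxA QP QQ mul0mx !subr0 addr0.
rewrite -mulmxA mulmxDl mul1mx (mulmxDl 1%:M Q) mul1mx QZ mulmxDr PZ.
rewrite subrK [RHS](ACl (1*4*(2*6)*(3*5))) /=.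
by rewrite !addNr !addr0.
Qed.

End Subgroup.

(** * Tits' inclusion of E_n(I^2) in F_n(I) *)

Section TrueElementary.
Variable I : set A.
Hypothesis idI : is_ideal I.
Let F := true_elementary n I.
Let subF : is_subgroup F := generated_subgroup _ _.

Lemma true_elementary_elem (i j : 'I_n) a :
  i != j -> I a -> matrices F (1%:M + a *: delta_mx i j).
Proof.
move=> ij Ia; exists (elem ij a) => //.
by apply: sub_gen_smallest; exists i, j, ij, a.
Qed.

Lemma true_elementary_col (m : 'I_n) (v : 'cV[A]_n) :
  v m 0 = 0 -> (forall i, I (v i 0)) ->
  matrices F (1%:M + v *m delta_mx 0 m).
Proof.
move=> vm0 Iv.
have -> : v *m delta_mx 0 m = \sum_(i | i != m) v i 0 *: delta_mx i m.
  rewrite [v in LHS]matrix_sum_delta mulmx_suml (bigD1 m) //=.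
  rewrite big_ord1 vm0 scale0r mul0mx add0r; apply: eq_bigr => i _.
  by rewrite big_ord1 -scalemxAl mul_delta_mx.
apply: matrices_sum1 => // [i j _ jm|i im].
  by rewrite -scalemxAl -scalemxAr mul_delta_mx_0 ?scaler0 // eq_sym.
exact: true_elementary_elem.
Qed.

Lemma true_elementary_row (m : 'I_n) (w : 'rV[A]_n) :
  w 0 m = 0 -> (forall j, I (w 0 j)) ->
  matrices F (1%:M + delta_mx m 0 *m w).
Proof.
move=> wm0 Iw.
have -> : delta_mx m 0 *m w = \sum_(j | j != m) w 0 j *: delta_mx m j.
  rewrite [w in LHS]row_sum_delta mulmx_sumr (bigD1 m) //=.
  rewrite wm0 scale0r mulmx0 add0r; apply: eq_bigr => j _.
  by rewrite -scalemxAr mul_delta_mx.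
apply: matrices_sum1 => // [i j im jm|j jm].
  by rewrite -scalemxAl -scalemxAr mul_delta_mx_0 ?scaler0.
by apply: true_elementary_elem => //; rewrite eq_sym.
Qed.

(** This is 1 + P Q for P = x v e_m and Q = y e_m w, hence the commutator of
    1 + P and 1 + Q; both have their entries in the m-th column or row. *)
Lemma transvection_mul (m : 'I_n) (v : 'cV[A]_n) (w : 'rV[A]_n)
    (x y : A) :
  I x -> I y -> w *m v = 0 -> v m 0 = 0 -> w 0 m = 0 ->
  matrices F (1%:M + (x * y) *: (v *m w)).
Proof.
move=> Ix Iy wv0 vm0 wm0.
have mv0 : delta_mx 0 m *m v = 0 :> 'M_1.
  by rewrite -rowE; apply/rowP=> i; rewrite !mxE ord1.
have mw0 : w *m delta_mx m 0 = 0 :> 'M_1.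
  by rewrite -colE; apply/colP=> i; rewrite !mxE ord1.
pose P (a : A) : 'M[A]_n := (a *: v) *m delta_mx 0 m.
pose Q (a : A) : 'M[A]_n := delta_mx m 0 *m (a *: w).
have HP a : I a -> matrices F (1%:M + P a).
  move=> Ia; apply: true_elementary_col => [|i].
    by rewrite mxE vm0 mulr0.
  by rewrite mxE; apply: idealMr.
have HQ a : I a -> matrices F (1%:M + Q a).
  move=> Ia; apply: true_elementary_row => [|i].
    by rewrite mxE wm0 mulr0.
  by rewrite mxE; apply: idealMr.
have -> : (x * y) *: (v *m w) = P x *m Q y.
  rewrite /P /Q mulmxA -(mulmxA _ (delta_mx 0 m)) mul_delta_mx.
  have -> : delta_mx 0 0 = 1%:M :> 'M[A]_1.
    by apply/matrixP=> i j; rewrite !mxE !ord1.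
  by rewrite mulmx1 -scalemxAl -scalemxAr scalerA.
apply: matrices_commutator => //.
- rewrite /P mulmxA -(mulmxA _ _ (x *: v)) -scalemxAr mv0 scaler0.
  by rewrite mulmx0 mul0mx.
- rewrite /Q -mulmxA (mulmxA (y *: w)) -scalemxAl mw0 scaler0 mul0mx.
  by rewrite mulmx0.
- rewrite /P /Q -mulmxA (mulmxA (y *: w)) -scalemxAl -scalemxAr wv0.
  by rewrite !scaler0 mul0mx mulmx0.
- exact: HP.
- exact: HQ.
- have -> : - P x = P (- x) by rewrite /P scaleNr mulNmx.
  by apply: HP; apply: idealN.
- have -> : - Q y = Q (- y) by rewrite /Q scaleNr mulmxN.
  by apply: HQ; apply: idealN.
Qed.

(** Quantified over all columns v, the set of such a is an ideal: a sum goes to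
    a product of transvections since w v = 0, and a multiple b a to the column
    b v.  So products of two elements of I suffice. *)
Lemma transvection_zero_coord (m : 'I_n) a (v : 'cV[A]_n) (w : 'rV[A]_n) :
  ideal_mul I I a -> w *m v = 0 -> v m 0 = 0 -> w 0 m = 0 ->
  matrices F (1%:M + a *: (v *m w)).
Proof.
move=> I2a wv0 vm0 wm0; move: a I2a v wv0 vm0.
pose T := [set a | forall v : 'cV[A]_n, w *m v = 0 -> v m 0 = 0 ->
  matrices F (1%:M + a *: (v *m w))].
suff: ideal_mul I I `<=` T by [].
apply: smallest_sub => [|_ [x Ix] [y Iy <-] v wv0 vm0]; last first.
  exact: (transvection_mul m).
split=> [v _ _|a b Ta Tb v wv0 vm0|b a Ta v wv0 vm0].
- by rewrite scale0r addr0; apply: matrices1.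
- rewrite scalerDl; apply: matrices_add1; [by []| |exact: Ta|exact: Tb].
  rewrite -scalemxAl -scalemxAr -mulmxA (mulmxA w) wv0 mul0mx mulmx0.
  by rewrite !scaler0.
- rewrite mulrC -scalerA scalemxAl; apply: Ta.
    by rewrite -scalemxAr wv0 scaler0.
  by rewrite mxE vm0 mulr0.
Qed.

(** The m-th coordinate of v contributes a matrix supported on row m, which is
    true elementary by itself; it can be split off since w kills both parts of
    v. *)
Lemma transvection_zero_row_coord (m : 'I_n) a (v : 'cV[A]_n) (w : 'rV[A]_n) :
  ideal_mul I I a -> w *m v = 0 -> w 0 m = 0 ->
  matrices F (1%:M + a *: (v *m w)).
Proof.
move=> I2a wv0 wm0; have Ia : I a by apply: ideal_mul_sub I2a.
pose vm : 'cV[A]_n := v m 0 *: delta_mx m 0.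
have wvm0 : w *m vm = 0.
  by rewrite -scalemxAr -colE; apply/colP=> i; rewrite !mxE ord1 wm0 mulr0.
have wv0' : w *m (v - vm) = 0 by rewrite mulmxBr wv0 wvm0 subr0.
rewrite -[in v *m w](subrK vm v) mulmxDl scalerDr.
apply: matrices_add1 => //.
- rewrite -scalemxAl -scalemxAr -mulmxA (mulmxA w) wvm0 mul0mx mulmx0.
  by rewrite !scaler0.
- apply: (transvection_zero_coord m) => //.
  by rewrite !mxE !eqxx mulr1 subrr.
- rewrite -scalemxAl scalerA scalemxAr; apply: true_elementary_row => [|j].
    by rewrite mxE wm0 mulr0.
  by rewrite mxE -mulrA; apply: idealMr.
Qed.

(** Suslin's decomposition: if u v = 1 and w v = 0, then w is the sum over all
    (k, l) of w_k u_l (v_l e_k - v_k e_l). *)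
Lemma true_elementary_transvection (n_ge3 : (3 <= n)%N) a
    (u : 'rV[A]_n) (v : 'cV[A]_n) (w : 'rV[A]_n) :
  ideal_mul I I a -> u *m v = 1%:M -> w *m v = 0 ->
  matrices F (1%:M + a *: (v *m w)).
Proof.
move=> I2a uv1 wv0.
have I2ideal := ideal_mul_ideal A I I.
pose r (kl : 'I_n * 'I_n) : 'rV[A]_n :=
  v kl.2 0 *: delta_mx 0 kl.1 - v kl.1 0 *: delta_mx 0 kl.2.
have deltav k : delta_mx 0 k *m v = (v k 0)%:M :> 'M_1.
  by rewrite -rowE; apply/rowP=> i; rewrite !mxE !ord1.
have rv0 kl : r kl *m v = 0.
  by rewrite mulmxBl -!scalemxAl !deltav !scale_scalar_mx mulrC subrr.
(* The first term of r sums to w by u v = 1, the second to 0 by w v = 0. *)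
have wE : w = \sum_kl (w 0 kl.1 * u 0 kl.2) *: r kl.
  rewrite -(pair_bigA _ (fun k l => (w 0 k * u 0 l) *: r (k, l))) /=.
  under eq_bigr => k _ do under eq_bigr => l _ do rewrite scalerBr !scalerA.
  under eq_bigr => k _ do rewrite sumrB.
  rewrite sumrB [X in _ - X]exchange_big /=.
  rewrite [X in _ - X]big1 => [|l _]; last first.
    rewrite -scaler_suml; under eq_bigr => k _ do rewrite mulrAC.
    rewrite -mulr_suml.
    have := congr1 (fun M : 'M_1 => M 0 0) wv0; rewrite !mxE => ->.
    by rewrite mul0r scale0r.
  rewrite subr0 [LHS]row_sum_delta; apply: eq_bigr => k _.
  rewrite -scaler_suml; under eq_bigr => l _ do rewrite -mulrA.
  rewrite -mulr_sumr.
  have := congr1 (fun M : 'M_1 => M 0 0) uv1; rewrite !mxE => ->.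
  by rewrite mulr1.
rewrite {1}wE mulmx_sumr scaler_sumr.
apply: matrices_sum1 => // [s t _ _|[k l] _].
  rewrite -!scalemxAr -!scalemxAl -mulmxA (mulmxA (r s)) rv0 mul0mx mulmx0.
  by rewrite !scaler0.
(* The row r (k, l) is supported on k and l. *)
have [m /andP[mk ml]] := ord_avoid n n_ge3 k l.
rewrite -scalemxAr scalerA; apply: (transvection_zero_row_coord m) => //.
  exact: (idealMr _ _ I2ideal).
by rewrite !mxE (negPf mk) (negPf ml) !mulr0 subr0.
Qed.

(** The conjugator may be any element of SL_n(A): only the relations between its
    rows and the columns of its inverse are used. *)
Lemma true_elementary_conj (n_ge3 : (3 <= n)%N) (h g : SL A n) :
  elem_set n (ideal_mul I I) h -> F (h ^ g)%g.
Proof.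
move=> [i [j [ij [a [I2a ->]]]]]; apply: matrices_SL.
have gV : SLval g^-1%g *m SLval g = 1%:M by rewrite -SLvalM mulVg.
have gK : SLval g *m SLval g^-1%g = 1%:M by rewrite -SLvalM mulgV.
have -> : SLval (elem ij a ^ g)%g =
    1%:M + a *: (col i (SLval g^-1%g) *m row j (SLval g)).
  rewrite conjgE !SLvalM /= /elem_mx mulmxDl mulmxDr mul1mx gV.
  rewrite colE rowE -scalemxAl -scalemxAr; congr (_ + _ *: _).
  by rewrite -!mulmxA (mulmxA (delta_mx i 0)) mul_delta_mx.
apply: (true_elementary_transvection n_ge3 a (row i (SLval g))) => //.
  rewrite -row_mul colE mulmxA gK mul1mx rowE mul_delta_mx.
  by apply/matrixP=> p q; rewrite !mxE !ord1.
rewrite colE rowE mulmxA -(mulmxA (delta_mx 0 j)) gK mulmx1.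
by rewrite mul_delta_mx_0 // eq_sym.
Qed.

End TrueElementary.

Lemma elem_set_elementary (I : set A) :
  elem_set n I `<=` @elementary_group A n.
Proof.
move=> _ [i [j [ij [a [_ ->]]]]].
by apply: sub_gen_smallest; exists i, j, ij, a.
Qed.

Lemma normal_elementary_normal (I : set A) :
  is_normal_subgroup (@elementary_group A n) (normal_elementary n I).
Proof.
have subE : is_subgroup (@elementary_group A n) by apply: generated_subgroup.
apply: normal_closure_normal => // [|k x]; first exact: elem_set_elementary.
exact: subgroup_conjg.
Qed.

Lemma normal_elementary_sub_true (I : set A) (n_ge3 : (3 <= n)%N) :
  is_ideal I ->
  normal_elementary n (ideal_mul I I) `<=` true_elementary n I.
Proof.
move=> idI; set F := true_elementary n I; set E := @elementary_group A n.
have [F1 FM FV] : is_subgroup F := generated_subgroup _ _.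
have subE : is_subgroup E := generated_subgroup _ _.
have [E1 EM EV] := subE.
(* Stability of N under conjugation holds by construction. *)
pose N := [set h | E h /\ forall g, F (h ^ g)%g].
suff NF : normal_elementary n (ideal_mul I I) `<=` N.
  by move=> h /NF[_ /(_ 1%g)]; rewrite conjg1.
apply: smallest_sub => [|h hI2]; last first.
  split=> [|g]; last exact: true_elementary_conj I idI n_ge3 h g hI2.
  exact: elem_set_elementary hI2.
split=> [|h [] //|k x Ek [Ex Fx]]; first split.
- by split=> // g; rewrite conj1g.
- move=> x y [Ex Fx] [Ey Fy]; split=> [|g]; first exact: EM.
  by rewrite conjMg; apply: FM.
- move=> x [Ex Fx]; split=> [|g]; first exact: EV.
  by rewrite conjVg; apply: FV.
- by split=> [|g]; [apply: (subgroup_conjg _ E)|rewrite -conjgM].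
Qed.

End Transvections.

(** * Linear parts modulo the square of an ideal *)

Section Congruences.
Variables (A : comPzRingType) (I : set A) (n : nat).
Hypothesis idI : is_ideal I.
Let I2 : set A := ideal_mul I I.
Let idI2 : is_ideal I2 := ideal_mul_ideal A I I.

Definition mx_in (J : set A) (M : 'M[A]_n) : Prop := forall i j, J (M i j).

Lemma mx_inD (J : set A) (M N : 'M[A]_n) :
  is_ideal J -> mx_in J M -> mx_in J N -> mx_in J (M + N).
Proof. by move=> idJ JM JN i j; rewrite mxE; apply: idealD. Qed.

Lemma mx_inM (M N : 'M[A]_n) : mx_in I M -> mx_in I N -> mx_in I2 (M *m N).
Proof.
move=> JM KN i j; rewrite mxE; apply: (ideal_sum _ _ idI2) => k _.
exact: ideal_mulM.
Qed.

Lemma mx_in_sub (M : 'M[A]_n) : mx_in I2 M -> mx_in I M.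
Proof. by move=> I2M i j; apply: ideal_mul_sub (I2M i j). Qed.

Lemma principal_congruenceE (J : set A) (g : SL A n) :
  principal_congruence n J g <-> mx_in J (SLval g - 1%:M).
Proof. by split=> Jg i j; have := Jg i j; rewrite !mxE. Qed.

(** X represents the class of g under the isomorphism of
    Gamma_n(I) / Gamma_n(I^2) with an additive subgroup of M_n(I / I^2). *)
Definition linear_part (g : SL A n) (X : 'M[A]_n) : Prop :=
  mx_in I (SLval g - 1%:M) /\ mx_in I2 (SLval g - 1%:M - X).

Lemma linear_part_self (g : SL A n) :
  principal_congruence n I g -> linear_part g (SLval g - 1%:M).
Proof.
move=> /principal_congruenceE Ig; split=> // i j.
by rewrite subrr mxE; apply: ideal0.
Qed.

(** The error term (g - 1)(h - 1) has its entries in I^2. *)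
Lemma linear_partM (g h : SL A n) X Y :
  linear_part g X -> linear_part h Y -> linear_part (g * h)%g (X + Y).
Proof.
move=> [Ig I2g] [Ih I2h].
have ghE : SLval (g * h)%g - 1%:M =
      (SLval g - 1%:M) *m (SLval h - 1%:M)
      + ((SLval g - 1%:M) + (SLval h - 1%:M)).
  rewrite SLvalM mulmxBr mulmx1 mulmxBl mul1mx.
  by rewrite addrA subrK addrA subrK.
have I2gh := mx_inM _ _ Ig Ih.
split; rewrite ghE.
  by do 2?apply: mx_inD => //; apply: mx_in_sub.
rewrite opprD -addrA; apply: mx_inD => //.
by rewrite [X in mx_in _ X](AC (2*2) ((1*3)*(2*4))); apply: mx_inD.
Qed.

Lemma linear_part1 : linear_part 1%g 0.
Proof. by split=> i j; rewrite ?subr0 subrr mxE; apply: ideal0. Qed.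

Definition linear_parts (H : set (SL A n)) : set 'M[A]_n :=
  [set X | exists2 h, H h & linear_part h X].

Lemma linear_parts_sum (H : set (SL A n)) (T : Type) (r : seq T) (P : pred T)
    (X : T -> 'M[A]_n) :
  is_subgroup H -> (forall t, P t -> linear_parts H (X t)) ->
  linear_parts H (\sum_(t <- r | P t) X t).
Proof.
move=> [H1 HM _] HX; apply: big_ind => // [|Y Z [g Hg gY] [h Hh hZ]].
  by exists 1%g => //; apply: linear_part1.
by exists (g * h)%g; [apply: HM|apply: linear_partM].
Qed.

Lemma linear_part_elem (i j : 'I_n) (ij : i != j) a :
  I a -> linear_part (elem ij a) (a *: delta_mx i j).
Proof.
move=> Ia; rewrite /linear_part /= /elem_mx addrAC subrr add0r.
by split=> p q; rewrite ?subrr !mxE; [apply: idealMr|apply: ideal0].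
Qed.

(** The source of diagonal entries: with the columns e_i, e_j, this
    conjugate is exactly 1 + a (e_i + e_j)(e_j - e_i)^T. *)
Lemma linear_part_conj (i j : 'I_n) (ij : i != j) (ji : j != i) a :
  I a -> linear_part (elem ij a ^ elem ji (- 1))%g
    (a *: (delta_mx i j + delta_mx j j - delta_mx i i - delta_mx j i)).
Proof.
move=> Ia.
have kV : (elem ji (- 1 : A))^-1%g = elem ji 1.
  apply: mulg1_eq; apply: val_inj; rewrite /= /elem_mx.
  rewrite mulmxDl mul1mx mulmxDr mulmx1 -scalemxAl -scalemxAr.
  by rewrite mul_delta_mx_0 // !scaler0 addr0 scaleNr addrK.
suff hE : SLval (elem ij a ^ elem ji (- 1))%g - 1%:M =
    a *: (delta_mx i j + delta_mx j j - delta_mx i i - delta_mx j i).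
  rewrite /linear_part hE.
  by split=> p q; rewrite ?subrr mxE; [apply: idealMr|apply: ideal0].
rewrite conjgE kV !SLvalM /= /elem_mx !scale1r scaleN1r.
have -> : (1%:M + a *: delta_mx i j) *m (1%:M - delta_mx j i) =
    1%:M - delta_mx j i + a *: (delta_mx i j - delta_mx i i).
  by rewrite mulmxDl mul1mx mulmxBr mulmx1 -scalemxAl mul_delta_mx scalerBr.
rewrite mulmxDl mul1mx mulmxDr mulmxBr mulmx1 mul_delta_mx_0 // subr0.
rewrite -scalemxAr mulmxBr !mul_delta_mx addrA [_ + delta_mx j i]addrAC subrK.
rewrite -addrA [LHS]addrAC subrr add0r -scalerDr; congr (_ *: _).
by rewrite [LHS](AC (2*2) (1*3*2*4)).
Qed.

(** In the Leibniz expansion, a permutation other than the identity moves at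
    least two indices and so contributes two off-diagonal factors from I; the
    identity contributes the product of the 1 + X i i. *)
Lemma det_linear (X : 'M[A]_n) :
  mx_in I X -> I2 (\det (1%:M + X) - 1 - \tr X).
Proof.
move=> IX; rewrite /determinant (bigD1 (1%g : 'S_n)) //= odd_perm1 expr0 mul1r.
rewrite [_ + _ - 1]addrAC [_ + _ - \tr X]addrAC; apply: (idealD _ _ idI2).
  suff [] : I2 (\prod_i (1%:M + X) i ((1%g : 'S_n) i) - 1 - \tr X) /\ I (\tr X).
    by [].
  rewrite /mxtrace; apply: (big_rec2 (fun p s => I2 (p - 1 - s) /\ I s)).
    by rewrite subr0 subrr; split; apply: ideal0.
  move=> i p s _ [I2ps Is]; split; last exact: idealD.
  rewrite perm1 !mxE eqxx mulr1n mulrDl mul1r.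
  have -> : p + X i i * p - 1 - (X i i + s) = (p - 1 - s) + X i i * (p - 1).
    rewrite mulrBr mulr1 opprD.
    by rewrite [LHS](AC (3*2) (1*3*5*(2*4))).
  apply: (idealD _ _ idI2) => //; apply: ideal_mulM => //.
  rewrite -(subrK s (p - 1)); apply: idealD => //.
  exact: ideal_mul_sub I2ps.
apply: (ideal_sum _ _ idI2) => s s1; apply: (idealMl _ _ idI2).
(* If s moves i, it also moves s i. *)
have [i si] : exists i, s i != i.
  apply/existsP; rewrite -negb_forall; apply: contra s1 => /forallP s1.
  by apply/eqP/permP => i; rewrite perm1; apply/eqP.
have offI (k : 'I_n) : s k != k -> I ((1%:M + X) k (s k)).
  by move=> sk; rewrite !mxE eq_sym (negPf sk) add0r.
rewrite (bigD1 i) // (bigD1 (s i)) //= mulrA.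
apply: (idealMr _ _ idI2); apply: ideal_mulM; apply: offI => //.
by rewrite (inj_eq perm_inj).
Qed.

Lemma congruence_trace (g : SL A n) :
  principal_congruence n I g -> I2 (\tr (SLval g - 1%:M)).
Proof.
move=> /principal_congruenceE/det_linear.
rewrite [1%:M + _]addrC subrK det_SL subrr sub0r => /(idealN _ _ idI2).
by rewrite opprK.
Qed.

(** The off-diagonal part of g - 1 is cancelled by elementary matrices over I;
    the diagonal part already lies in I^2. *)
Lemma secondary_congruence_mod_true (g : SL A n) :
  secondary_congruence n I g ->
  exists2 h, true_elementary n I h & principal_congruence n I2 (g * h)%g.
Proof.
move=> [Ig I2g].
pose Y : 'M[A]_n := \sum_i \sum_(j | j != i) (- SLval g i j) *: delta_mx i j.
have [h Fh hY] : linear_parts (true_elementary n I) Y.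
  apply: linear_parts_sum => [|i _]; first exact: generated_subgroup.
  apply: linear_parts_sum => [|j ji]; first exact: generated_subgroup.
  have ij : i != j by rewrite eq_sym.
  have Iij : I (- SLval g i j).
    apply: idealN => //; have := Ig i j.
    by rewrite !mxE (negPf ij) subr0.
  exists (elem ij (- SLval g i j)); last exact: linear_part_elem.
  by apply: sub_gen_smallest; exists i, j, ij, (- SLval g i j).
exists h => //; apply/principal_congruenceE.
have [_ I2gh] := linear_partM _ _ _ _ (linear_part_self g Ig) hY.
rewrite -(subrK (SLval g - 1%:M + Y) (SLval (g * h)%g - 1%:M)).
apply: mx_inD => // p q.
have YE : Y p q = if p == q then 0 else - SLval g p q.
  rewrite /Y summxE (bigD1 p) //= [X in _ + X]big1 => [|i ip]; last first.
    rewrite summxE big1 // => j _.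
    by rewrite !mxE eq_sym (negPf ip) mulr0.
  rewrite addr0 summxE; case: (eqVneq p q) => [<-|pq].
    rewrite big1 // => j jp.
    by rewrite !mxE [p == j]eq_sym (negPf jp) andbF mulr0.
  rewrite (bigD1 q) 1?eq_sym //= big1 => [|j /andP[_ jq]].
    by rewrite !mxE !eqxx mulr1 addr0.
  by rewrite !mxE [q == j]eq_sym (negPf jq) andbF mulr0.
rewrite mxE YE !mxE; case: (eqVneq p q) => [<-|pq].
  by rewrite addr0; apply: I2g.
by rewrite subr0 subrr; apply: ideal0.
Qed.

(** Each diagonal entry of g - 1 other than the m-th is transferred to position
    m, where the trace of g - 1 accumulates. *)
Lemma principal_congruence_mod_normal (m : 'I_n) (g : SL A n) :
  principal_congruence n I g ->
  exists2 h, normal_elementary n I h & secondary_congruence n I (g * h)%g.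
Proof.
move=> Ig.
pose X : 'M[A]_n := SLval g - 1%:M.
pose Z i : 'M[A]_n := delta_mx i m + delta_mx m m - delta_mx i i - delta_mx m i.
pose Y : 'M[A]_n := \sum_(i | i != m) X i i *: Z i.
have [nE _ EJ] := normal_elementary_normal A n I.
have [h Eh hY] : linear_parts (normal_elementary n I) Y.
  apply: linear_parts_sum => // i im; have mi : m != i by rewrite eq_sym.
  have Ii : I (X i i) by move/principal_congruenceE: Ig; apply.
  exists (elem im (X i i) ^ elem mi (- 1))%g; last exact: linear_part_conj.
  apply: EJ; apply: sub_gen_smallest.
    by exists m, i, mi, (- 1).
  by exists i, m, im, (X i i).
exists h => //.
have [Igh I2gh] := linear_partM _ _ _ _ (linear_part_self g Ig) hY.
split=> [|p]; first exact/principal_congruenceE.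
have -> : SLval (g * h)%g p p - 1 = (SLval (g * h)%g - 1%:M) p p.
  by rewrite !mxE eqxx.
rewrite -(subrK (X + Y) (SLval (g * h)%g - 1%:M)) mxE.
apply: (idealD _ _ idI2) => //; rewrite mxE /Y summxE.
have [->|pm] := eqVneq p m.
  suff -> : X m m + \sum_(i | i != m) (X i i *: Z i) m m = \tr X.
    exact: congruence_trace.
  rewrite /mxtrace [RHS](bigD1 m) //=; congr (_ + _); apply: eq_bigr => i im.
  rewrite !mxE !eqxx [m == i]eq_sym (negPf im) /=.
  by rewrite add0r !subr0 mulr1.
rewrite (bigD1 p) //= big1 => [|i /andP[im ip]].
  rewrite !mxE !eqxx (negPf pm) /= add0r sub0r subr0 addr0 mulrN1 subrr.
  exact: ideal0.
by rewrite !mxE [p == i]eq_sym (negPf ip) (negPf pm) /= !subr0 addr0 mulr0.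
Qed.

End Congruences.

(** * Surjections between the quotients *)

Theorem theorem4 (A : comPzRingType) (I : set A) (n : nat)
    (idealI : is_ideal I) (n_ge3 : (3 <= n)%N) :
  let I2 := ideal_mul I I in
  [/\ principal_congruence n I2 `<=` secondary_congruence n I,
      secondary_congruence n I `<=` principal_congruence n I,
      induces_surjection
        (principal_congruence n I2) (normal_elementary n I2)
        (secondary_congruence n I) (true_elementary n I)
    & induces_surjection
        (secondary_congruence n I) (true_elementary n I)
        (principal_congruence n I) (normal_elementary n I)].
Proof.
move=> I2.
have K12 : principal_congruence n I2 `<=` secondary_congruence n I.
  move=> g I2g; split=> [i j|i]; first by apply: ideal_mul_sub (I2g i j).
  by have := I2g i i; rewrite !mxE eqxx.
have K23 : secondary_congruence n I `<=` principal_congruence n I.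
  by move=> g [].
have subF : is_subgroup (true_elementary n I) by apply: generated_subgroup.
have nE J := normal_elementary_normal A n J.
split=> //; apply: induces_surjectionP => //.
- by case: (nE I2).
- exact: normal_elementary_sub_true.
- exact: secondary_congruence_mod_true.
- by case: (nE I).
- case: (nE I) => subE _ _; apply: smallest_sub => //.
  exact: sub_gen_smallest.
- exact: principal_congruence_mod_normal (Ordinal n_ge3).
Qed.
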